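(* Let $n,k,n',k'$ be integers with $\frac{n+1}{2}<k<n$, $n/k=n'/k'$, and $k,k'$ both even. Let $G$ and $G'$ be graphs with $H_{n,k}\subseteq G\subseteq H'_{n,k}$ and $H_{n',k'}\subseteq G'\subseteq H'_{n',k'}$. If there is a homomorphism $G\to G'$, then $n'$ and $k'$ are integer multiples of $n$ and $k$, respectively. Moreover, any such homomorphism is injective, and therefore $G$ is (isomorphic to) a subgraph of $G'$.
   Context: For integers $m\ge j$ with $j$ even, $H_{m,j}$ is the graph whose vertices are the even-weight elements of $\mathbb{Z}_2^m$, with $x\sim y$ iff the Hamming distance $d(x,y)$ equals $j$; and $H'_{m,j}$ is the graph on the same vertex set with $x\sim y$ iff $d(x,y)\ge j$. The inclusions $H_{m,j}\subseteq G\subseteq H'_{m,j}$ mean $G$ has the same vertex set and its edge set lies between the two edge sets. A homomorphism is an adjacency-preserving map between vertex sets. *)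

(* Defs.v *)
From mathcomp Require Import all_boot.
Set Implicit Arguments. Unset Strict Implicit. Unset Printing Implicit Defensive.

(* Z_2^m represented as boolean vectors indexed by 'I_m. *)
Definition weight (m : nat) (x : {ffun 'I_m -> bool}) : nat := #|[set i | x i]|.

Definition evenvec (m : nat) : Type :=
  {x : {ffun 'I_m -> bool} | ~~ odd (weight x)}.

Definition hdist (m : nat) (x y : evenvec m) : nat :=
  #|[set i | val x i != val y i]|.

Definition H_rel (m j : nat) (x y : evenvec m) : Prop := hdist x y = j.
Definition H'_rel (m j : nat) (x y : evenvec m) : Prop := j <= hdist x y.

Definition between_graph (m j : nat) (G : evenvec m -> evenvec m -> Prop) : Prop :=
  (forall x y, G x y -> G y x) /\
  (forall x y, H_rel j x y -> G x y) /\
  (forall x y, G x y -> H'_rel j x y).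

Definition is_hom (m m' : nat) (G : evenvec m -> evenvec m -> Prop)
  (G' : evenvec m' -> evenvec m' -> Prop) (f : evenvec m -> evenvec m') : Prop :=
  forall x y, G x y -> G' (f x) (f y).

(* Main.v *)
Require Import Defs.
From mathcomp Require Import all_boot all_order all_algebra ring lra zify.
Set Implicit Arguments. Unset Strict Implicit. Unset Printing Implicit Defensive.
Import Order.TTheory GRing.Theory Num.Theory.

(** Each coordinate i' of f gives a {1,-1}-valued function g on the even-weight
vectors.  Extended by zero to the whole cube, its quadratic form on the graph of
distance k is at least t * |g|^2, where t is the least eigenvalue, attained
exactly on the characters of weight 1 and n - 1; this is a strict inequality
between Krawtchouk numbers.  Since n / k = n' / k', the conditions
d(f x, f y) >= k' on edges force equality in the sum of these bounds over i'.
Hence f multiplies distances by n'/n on edges, and every g is a combination of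
the n coordinate signs.  As g takes only the values 1 and -1 and n > 4, g is a
single signed coordinate, so f selects coordinates (up to complement).
All k-subsets of coordinates being selected k' times in total, each coordinate
is selected equally often, namely n'/n times. *)

(** * Krawtchouk numbers *)

Section Krawtchouk.
Local Open Scope ring_scope.

(* The eigenvalue, on characters of weight a, of the distance-k graph on the
(a + b)-dimensional cube. *)
Definition kraw (a b k : nat) : rat := ((1 - 'X) ^+ a * (1 + 'X) ^+ b)`_k.

Lemma krawSl a b k : kraw a.+1 b k.+1 = kraw a b k.+1 - kraw a b k.
Proof. by rewrite /kraw exprS -mulrA mulrBl mul1r coefB coefXM. Qed.

Lemma krawSr a b k : kraw a b.+1 k.+1 = kraw a b k.+1 + kraw a b k.
Proof. by rewrite /kraw exprS mulrCA mulrDl mul1r coefD coefXM. Qed.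

Lemma kraw_const a b : kraw a b 0 = 1.
Proof. 
by rewrite /kraw -horner_coef0 !hornerE ?subr0 ?addr0 !expr1n ?mulr1.
Qed.

Lemma kraw0l b k : kraw 0 b k = 'C(b, k)%:R.
Proof.
elim: b k => [|b IH] [|k]; rewrite ?kraw_const ?bin0 //.
  by rewrite /kraw !expr0 mulr1 coef1 bin0n.
by rewrite krawSr !IH binS natrD.
Qed.

Lemma kraw0r a k : kraw a 0 k = (-1) ^+ k * 'C(a, k)%:R.
Proof.
elim: a k => [|a IH] [|k]; rewrite ?kraw_const ?bin0 ?mulr1 //.
  by rewrite kraw0l bin0n mulr0.
by rewrite krawSl !IH binS natrD exprS; ring.
Qed.

Lemma kraw1l b k : kraw 1 b k.+1 = 'C(b, k.+1)%:R - 'C(b, k)%:R.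
Proof. by rewrite krawSl !kraw0l. Qed.

Lemma kraw_small a b k : (a + b < k)%N -> kraw a b k = 0.
Proof.
elim: a k => [|a IH] [|k] //; first by move=> h; rewrite kraw0l bin_small.
by move=> h; rewrite krawSl !IH ?subrr //; lia.
Qed.

(** Reversing the coefficients of [(1 - X)^a (1 + X)^b] multiplies it by [(-1)^a]. *)
Lemma kraw_sym a b i j : (i + j = a + b)%N ->
  kraw a b i = (-1) ^+ a * kraw a b j.
Proof.
elim: a i j => [|a IH] i j eij.
  by rewrite !kraw0l mul1r -(@bin_sub b i) //; [congr ('C(_, _)%:R)|]; lia.
case: i j eij => [|i] [|j] eij //.
- rewrite krawSl kraw_const kraw_small ?(IH j 0); try lia.
  by rewrite kraw_const exprS; have := signr_odd rat a; case: (odd a) => /= <-; ring.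
- rewrite krawSl kraw_const kraw_small ?(IH i 0); try lia.
  by rewrite kraw_const exprS; ring.
rewrite !krawSl (IH i.+1 j) ?(IH i j.+1) ?exprS; try lia.
by ring.
Qed.

Lemma kraw_central a b l : (a + b = l + l)%N -> odd a -> kraw a b l = 0.
Proof.
move=> e oa; have := @kraw_sym a b l l (esym e).
by rewrite -signr_odd oa expr1; lra.
Qed.

(* The right-hand side is [- kraw 1 (a + b + 1) l.+1].  Splitting off one factor
1 + X or 1 - X bounds the left-hand side by two smaller instances whose bounds add
up to it; when 2 * l = a + b + 1 one of the two terms is central and vanishes. *)
Lemma kraw_bound a b l : (a + b + 1 <= 2 * l)%N ->
  `|kraw a.+1 b.+1 l.+1| <= 'C(a + b + 1, l)%:R - 'C(a + b + 1, l.+1)%:R.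
Proof.
move: {2}(a + b)%N (erefl (a + b)%N) => N.
elim: N a b l => [|N IH] a b l eN hl.
  have -> : a = 0%N by lia.
  have -> : b = 0%N by lia.
  rewrite kraw1l (@bin_small _ l.+1); last by lia.
  by rewrite sub0r subr0 normrN normr_nat.
case: l hl => [|l] hl; first by lia.
have [hl1|hl1] : (a + b + 1 = 2 * l.+1 \/ a + b + 1 < 2 * l.+1)%N by lia.
  have eB : 'C(a + b + 1, l.+1)%:R - 'C(a + b + 1, l.+2)%:R =
     'C(a + b, l.+1)%:R - 'C(a + b, l.+2)%:R :> rat.
    rewrite addn1 !binS !natrD.
    have -> : 'C(a + b, l) = 'C(a + b, l.+1).
      by rewrite -(@bin_sub (a + b) l.+1); [congr 'C(_, _)|]; lia.
    by ring.
  (* The parity of [a] decides which factor to split off: the central coefficient left over must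
     have an odd exponent of [1 - X]. *)
  rewrite eB; have [oa|ea] := boolP (odd a).
    case: a oa eN hl hl1 {eB} => [|a] // oa eN hl hl1.
    rewrite krawSl (@kraw_central a.+1 b.+1 l.+1) ?subr0 //; last by lia.
    have -> : (a.+1 + b = a + b + 1)%N by lia.
    by apply: IH; lia.
  case: b eN hl hl1 {eB} => [|b] eN hl hl1; first by lia.
  rewrite krawSr (@kraw_central a.+1 b.+1 l.+1) ?addr0 //; last by lia.
  have -> : (a + b.+1 = a + b + 1)%N by lia.
    by apply: IH; lia.
have step : forall x y : rat, `|x| <= 'C(N + 1, l.+1)%:R - 'C(N + 1, l.+2)%:R ->
    `|y| <= 'C(N + 1, l)%:R - 'C(N + 1, l.+1)%:R ->
    `|x| + `|y| <= 'C(N.+1 + 1, l.+1)%:R - 'C(N.+1 + 1, l.+2)%:R :> rat.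
  by move=> x y hx hy; rewrite addSn !binS !natrD; lra.
rewrite eN.
case: b eN hl hl1 => [|b] eN hl hl1; last first.
  have eN' : (N = a + b)%N by lia.
  rewrite krawSr; apply: le_trans (ler_normD _ _) _.
  by apply: step; rewrite eN'; apply: IH; lia.
case: a eN hl hl1 => [|a] eN hl hl1; first by lia.
have eN' : (N = a + 0)%N by lia.
rewrite krawSl; apply: le_trans (ler_normB _ _) _.
by apply: step; rewrite eN'; apply: IH; lia.
Qed.

(** Same splitting as for [kraw_bound]. Strictness holds in the base case and survives because one
    of the two smaller instances is always strict. *)
Lemma kraw_bound_lt a b l : (a + b + 3 < 2 * l)%N -> (l < a + b + 3)%N ->
  `|kraw a.+2 b.+2 l.+1| < 'C(a + b + 3, l)%:R - 'C(a + b + 3, l.+1)%:R.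
Proof.
move: {2}(a + b)%N (erefl (a + b)%N) => N.
elim: N a b l => [|N IH] a b l eN hl hl2.
  have -> : a = 0%N by lia.
  have -> : b = 0%N by lia.
  have -> : l = 2%N by lia.
  (* The polynomial is [(1 - X^2)^2], which has no term of odd degree. *)
  have -> : kraw 2 2 3 = 0.
    by rewrite !(krawSl, kraw0l, kraw_const) !binS !bin0 !bin0n /=; ring.
  by rewrite normr0 subr_gt0 ltr_nat.
case: l hl hl2 => [|l] hl hl2; first by lia.
have step : forall x y : rat,
    `|x| <= 'C(N + 3, l.+1)%:R - 'C(N + 3, l.+2)%:R ->
    `|y| <= 'C(N + 3, l)%:R - 'C(N + 3, l.+1)%:R ->
    `|x| < 'C(N + 3, l.+1)%:R - 'C(N + 3, l.+2)%:R \/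
    `|y| < 'C(N + 3, l)%:R - 'C(N + 3, l.+1)%:R ->
    `|x| + `|y| < 'C(N.+1 + 3, l.+1)%:R - 'C(N.+1 + 3, l.+2)%:R :> rat.
  by move=> x y hx hy hs; rewrite addSn !binS !natrD; case: hs; lra.
have weak : forall a b m, (a + b = N)%N -> (N + 3 <= 2 * m)%N ->
    `|kraw a.+2 b.+2 m.+1| <= 'C(N + 3, m)%:R - 'C(N + 3, m.+1)%:R.
  move=> a' b' m eN' hm; have -> : (N + 3 = a'.+1 + b'.+1 + 1)%N by lia.
  by apply: kraw_bound; lia.
have strict : forall a b, (a + b = N)%N ->
    `|kraw a.+2 b.+2 l.+2| < 'C(N + 3, l.+1)%:R - 'C(N + 3, l.+2)%:R \/
    `|kraw a.+2 b.+2 l.+1| < 'C(N + 3, l)%:R - 'C(N + 3, l.+1)%:R.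
  (* The instance at [l.+1] is strict unless [l.+1] reaches the excluded end [N + 3]; then the
     instance at [l] is strict. *)
  move=> a' b' eN'; have [h|h] := leqP (a + b + 3) l.+2.
    by right; rewrite -eN'; apply: IH; lia.
  by left; rewrite -eN'; apply: IH; lia.
rewrite eN.
case: b eN hl hl2 strict => [|b] eN hl hl2 strict; last first.
  rewrite krawSr; apply: le_lt_trans (ler_normD _ _) _.
  by apply: step; [apply: weak|apply: weak|apply: strict]; lia.
case: a eN hl hl2 strict => [|a] eN hl hl2 strict; first by lia.
rewrite krawSl; apply: le_lt_trans (ler_normB _ _) _.
by apply: step; [apply: weak|apply: weak|apply: strict]; lia.
Qed.

(** Divided by the degree ['C(n, k)], the weight-1 eigenvalue is [1 - 2k/n], a function of [n / k]
    alone. This is how the equality of ratios enters. *)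
Lemma kraw1_mul n k : (0 < k <= n)%N ->
  n%:R * kraw 1 n.-1 k = (n%:R - 2 * k%:R) * kraw 0 n k.
Proof.
case: n k => [|n] [|k] // _; rewrite kraw1l kraw0l /=.
have /(congr1 (fun m : nat => m%:R : rat)) := mul_bin_diag n.+1 k.
rewrite !natrM binS natrD /=; nra.
Qed.

Lemma kraw1_lt0 n k : (n < 2 * k)%N -> (k <= n)%N -> kraw 1 n.-1 k < 0.
Proof.
move=> h1 h2; have n0 : (0 : rat) < n%:R by rewrite ltr0n; lia.
rewrite -(pmulr_rlt0 _ n0) kraw1_mul; last by lia.
rewrite pmulr_llt0; first by rewrite subr_lt0 -natrM ltr_nat.
by rewrite kraw0l ltr0n bin_gt0.
Qed.

(** At weight 0 and at full weight the eigenvalue is a binomial coefficient with sign [1] or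
    [(-1)^k], hence nonnegative for even [k], while the weight-1 eigenvalue is negative. *)
Lemma kraw_min_end a b k : ~~ odd k -> (a + b + 1 < 2 * k)%N -> (k < a + b)%N ->
  (a == 0%N) || (b == 0%N) -> kraw 1 (a + b).-1 k < kraw a b k.
Proof.
move=> ek h1 h2 ab0; apply: (@lt_le_trans _ _ 0); first by apply: kraw1_lt0; lia.
case/orP: ab0 => /eqP->; first by rewrite kraw0l ler0n.
by rewrite kraw0r -signr_odd (negbTE ek) mul1r ler0n.
Qed.

(** Away from the ends this is [kraw_bound] read as a lower bound, its right-hand side being minus
    the weight-1 eigenvalue. *)
Lemma kraw_min a b k : ~~ odd k -> (a + b + 1 < 2 * k)%N -> (k < a + b)%N ->
  kraw 1 (a + b).-1 k <= kraw a b k.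
Proof.
move=> ek h1 h2; have [|ab0] := boolP ((a == 0%N) || (b == 0%N)).
  by move=> ab0; apply/ltW/kraw_min_end.
case: a b k ek h1 h2 ab0 => [|a] [|b] [|k] // ek h1 h2 _.
have := @kraw_bound a b k; rewrite kraw1l.
have -> : (a.+1 + b.+1).-1 = (a + b + 1)%N by lia.
by move=> /(_ ltac:(lia)); rewrite ler_norml => /andP[]; lra.
Qed.

(** Both exclusions are forced: replacing [X] by [-X] swaps [a] and [b] and, for even [k], keeps the
    coefficient, so weights 1 and n - 1 share the minimum. *)
Lemma kraw_min_lt a b k : ~~ odd k -> (a + b + 1 < 2 * k)%N -> (k < a + b)%N ->
  a != 1%N -> b != 1%N -> kraw 1 (a + b).-1 k < kraw a b k.
Proof.
move=> ek h1 h2 a1 b1; have [|ab0] := boolP ((a == 0%N) || (b == 0%N)).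
  exact: kraw_min_end.
case: a b k ek h1 h2 a1 b1 ab0 => [|[|a]] [|[|b]] [|k] // ek h1 h2 _ _ _.
have := @kraw_bound_lt a b k; rewrite kraw1l.
have -> : (a.+2 + b.+2).-1 = (a + b + 3)%N by lia.
by move=> /(_ ltac:(lia) ltac:(lia)); rewrite ltr_norml => /andP[]; lra.
Qed.

End Krawtchouk.

(** * Fourier analysis on the cube *)

Section Fourier.
Local Open Scope ring_scope.
Variable n : nat.
Local Notation vec := {ffun 'I_n -> bool}.
Implicit Types S x y z : vec.

Definition vadd x y : vec := [ffun i => x i (+) y i].
Definition vzero : vec := [ffun=> false].
Definition chi S x : rat := \prod_i (-1) ^+ (S i && x i).
Definition fourier (g : vec -> rat) S : rat := \sum_x g x * chi S x.

Lemma vaddK x : involutive (vadd x).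
Proof. by move=> y; apply/ffunP => i; rewrite !ffunE addbA addbb. Qed.

Lemma vadd_eq0 x y : (vadd x y == vzero) = (x == y).
Proof.
apply/eqP/eqP => [/ffunP e|->]; apply/ffunP => i; last by rewrite !ffunE addbb.
by have := e i; rewrite !ffunE; case: (x i); case: (y i).
Qed.

Lemma chiC S x : chi S x = chi x S.
Proof. by apply: eq_bigr => i _; rewrite andbC. Qed.

Lemma chiD S x y : chi S (vadd x y) = chi S x * chi S y.
Proof.
rewrite /chi -big_split; apply: eq_bigr => i _ /=; rewrite ffunE.
by case: (S i); case: (x i); case: (y i).
Qed.

(** Orthogonality of characters: the sum factors into [1 + (-1)^(x i)] over the coordinates, and a
    single true [x i] kills the product. *)
Lemma sum_chi x : \sum_S chi S x = 2 ^+ n * (x == vzero)%:R.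
Proof.
rewrite -(bigA_distr_bigA (fun i b => (-1) ^+ (b && x i))) /=.
have [->|/eqP nx] := eqVneq x vzero.
  rewrite mulr1 (eq_bigr (fun=> 2)) ?prodr_const ?card_ord // => i _.
  by rewrite big_bool /= ffunE.
have [i xi] : exists i, x i.
  apply/existsP; apply: contra_notT nx => /existsPn h; apply/ffunP => i.
  by rewrite ffunE; apply/negbTE/h.
by rewrite (bigD1 i) //= big_bool /= xi addNr mul0r mulr0.
Qed.

(** Convolution by [w] is diagonal in the characters. Expanding the three transforms and summing
    over [S] first leaves only [z = x + y]. *)
Lemma fourier_quadratic (w g : vec -> rat) :
  \sum_S fourier w S * fourier g S ^+ 2 =
  2 ^+ n * \sum_x \sum_y w (vadd x y) * (g x * g y).
Proof.
transitivity (\sum_S \sum_x \sum_y \sum_z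
    (w z * (g x * g y)) * chi S (vadd z (vadd x y))).
  apply: eq_bigr => S _; rewrite expr2 /fourier big_distrlr mulr_sumr.
  apply: eq_bigr => x _; rewrite mulr_sumr; apply: eq_bigr => y _.
  rewrite mulr_suml; apply: eq_bigr => z _; rewrite !chiD /=; ring.
rewrite exchange_big mulr_sumr; apply: eq_bigr => x _.
rewrite exchange_big mulr_sumr; apply: eq_bigr => y _.
rewrite exchange_big (bigD1 (vadd x y)) //= -mulr_sumr sum_chi vadd_eq0 eqxx mulr1.
rewrite big1 ?addr0; first by ring.
by move=> z zxy; rewrite -mulr_sumr sum_chi vadd_eq0 (negbTE zxy) /= !mulr0.
Qed.

Lemma fourier_inversion (g : vec -> rat) x :
  \sum_S fourier g S * chi S x = 2 ^+ n * g x.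
Proof.
transitivity (\sum_S \sum_y g y * chi S (vadd y x)).
  by apply: eq_bigr => S _; rewrite mulr_suml; apply: eq_bigr => y _; rewrite chiD mulrA.
rewrite exchange_big (bigD1 x) //= -mulr_sumr sum_chi vadd_eq0 eqxx mulr1.
rewrite big1 ?addr0 1?mulrC // => y nyx.
by rewrite -mulr_sumr sum_chi vadd_eq0 (negbTE nyx) !mulr0.
Qed.

Lemma weightE x : weight x = (\sum_i x i)%N.
Proof.
rewrite /weight -sum1dep_card big_mkcond /=; apply: eq_bigr => i _.
by case: (x i).
Qed.

(** Generating function: in the product of the factors [1 + (-1)^(S i) X], choosing the second term
    exactly where [z i] holds contributes [chi S z] in degree [weight z]. *)
Lemma fourier_weight k S :
  fourier (fun z => (weight z == k)%:R) S = kraw (weight S) (n - weight S) k.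
Proof.
have -> : kraw (weight S) (n - weight S) k =
    (\prod_(i < n) \sum_b (if b then (-1) ^+ S i *: 'X else 1))`_k.
  rewrite /kraw (bigID (fun i => S i)) /=; congr ((_ * _ : {poly rat})`_k).
    rewrite (eq_bigr (fun=> 1 - 'X)).
      by rewrite prodr_const /weight cardsE.
    by move=> i Si; rewrite big_bool /= Si scaleN1r addrC.
  rewrite (eq_bigr (fun=> 1 + 'X)).
    rewrite prodr_const /weight cardsE; congr (_ ^+ _).
    have := cardC (fun i => S i); rewrite card_ord => e.
    by rewrite -[RHS](addKn #|[eta S]|); congr (_ - _)%N; exact: esym e.
  by move=> i /negbTE Si; rewrite big_bool /= Si scale1r addrC.
rewrite bigA_distr_bigA coef_sum; apply: eq_bigr => z _ /=.
have -> : \prod_i (if z i then (-1) ^+ S i *: 'X else 1) =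
    chi S z *: 'X^(weight z) :> {poly rat}.
  rewrite weightE expr_sum /chi -scaler_prod; apply: eq_bigr => i _.
  by case: (z i); rewrite ?andbT ?andbF ?scale1r.
by rewrite coefZ coefXn eq_sym mulrC.
Qed.

Lemma fourier_zero S : fourier (fun z => (z == vzero)%:R) S = 1.
Proof.
rewrite /fourier (bigD1 vzero) //= eqxx mul1r big1 ?addr0.
  by rewrite /chi big1 // => i _; rewrite ffunE andbF.
by move=> x /negbTE->; rewrite mul0r.
Qed.

Lemma kraw_quadratic k (t : rat) (g : vec -> rat) :
  \sum_S (kraw (weight S) (n - weight S) k - t) * fourier g S ^+ 2 =
  2 ^+ n * (\sum_x \sum_(y | weight (vadd x y) == k) g x * g y
            - t * \sum_x g x ^+ 2).
Proof.
(* The kernel of the distance-[k] adjacency operator minus [t] times the identity. *)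
pose w z : rat := (weight z == k)%:R - t * (z == vzero)%:R.
transitivity (\sum_S fourier w S * fourier g S ^+ 2).
  apply: eq_bigr => S _; congr (_ * _).
  have {1}-> : t = t * fourier (fun z => (z == vzero)%:R) S.
    by rewrite fourier_zero mulr1.
  rewrite -fourier_weight /fourier mulr_sumr -sumrB.
  by apply: eq_bigr => z _; rewrite /w; ring.
rewrite fourier_quadratic; congr (_ * _).
rewrite mulr_sumr -sumrB; apply: eq_bigr => x _.
have -> : t * g x ^+ 2 = \sum_y t * (y == x)%:R * (g x * g y).
  rewrite (bigD1 x) //= eqxx mulr1 big1 ?addr0 ?expr2 // => y /negbTE->.
  by rewrite mulr0 mul0r.
rewrite [\sum_(y | weight _ == k) _]big_mkcond /= -sumrB; apply: eq_bigr => y _.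
rewrite /w vadd_eq0 (eq_sym y); case: (weight _ == k); rewrite /= ?mulr1n ?mulr0n; ring.
Qed.

End Fourier.

(** * Functions of extremal Rayleigh quotient *)

Section Coordinates.
Local Open Scope ring_scope.
Variable n : nat.
Local Notation vec := {ffun 'I_n -> bool}.
Implicit Types (S x y : vec) (i j l : 'I_n).

Definition delta i : vec := [ffun j => j == i].
Definition compl S : vec := [ffun i => ~~ S i].

Lemma odd_weightD x y :
  odd (weight (vadd x y)) = odd (weight x) (+) odd (weight y).
Proof.
rewrite !weightE !(big_morph odd oddD (erefl _)) -big_split.
by apply: eq_bigr => i _ /=; rewrite ffunE !oddb.
Qed.

Lemma weight_zero : weight (vzero n) = 0%N.
Proof. by rewrite weightE big1 // => i _; rewrite ffunE. Qed.

Lemma weight_delta i : weight (delta i) = 1%N.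
Proof.
rewrite weightE (bigD1 i) //= ffunE eqxx big1 // => j /negbTE ji.
by rewrite ffunE ji.
Qed.

Lemma weight_compl S : (weight (compl S) + weight S = n)%N.
Proof.
rewrite !weightE -big_split -[RHS]card_ord -sum1_card /=.
by apply: eq_bigr => i _; rewrite ffunE; case: (S i).
Qed.

Lemma complK : involutive compl.
Proof. by move=> S; apply/ffunP => i; rewrite !ffunE negbK. Qed.

Lemma delta_inj : injective delta.
Proof.
by move=> i j /ffunP/(_ i); rewrite !ffunE eqxx => /esym/eqP.
Qed.

Lemma weight1P S : reflect (exists i, S = delta i) (weight S == 1%N).
Proof.
apply: (iffP cards1P) => [[i /setP e]|[i ->]]; exists i.
  by apply/ffunP => j; have := e j; rewrite !inE ffunE.
by apply/setP => j; rewrite !inE ffunE.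
Qed.

Lemma chi_delta i x : chi (delta i) x = (-1) ^+ x i.
Proof.
rewrite /chi (bigD1 i) //= ffunE eqxx big1 ?mulr1 // => j /negbTE ji.
by rewrite ffunE ji.
Qed.

(** The two characters differ by the all-ones character [(-1)^(weight x)]. *)
Lemma chi_compl S x : ~~ odd (weight x) -> chi (compl S) x = chi S x.
Proof.
move=> ex; have -> : compl S = vadd S [ffun=> true].
  by apply/ffunP => i; rewrite !ffunE addbT.
rewrite chiC chiD chiC -[RHS]mulr1; congr (_ * _).
transitivity ((-1) ^+ weight x : rat); last by rewrite -signr_odd (negbTE ex).
rewrite weightE expr_sum; apply: eq_bigr => i _.
by rewrite ffunE andbT.
Qed.

Lemma sum_sign x y :
  \sum_i (-1) ^+ x i * (-1) ^+ y i = n%:R - 2 * (weight (vadd x y))%:R :> rat.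
Proof.
have -> : n%:R = \sum_(i < n) 1 :> rat by rewrite sumr_const card_ord.
rewrite weightE natr_sum mulr_sumr -sumrB; apply: eq_bigr => i _.
by rewrite ffunE; case: (x i); case: (y i); rewrite /= ?mulr1n ?mulr0n; ring.
Qed.

(** Complementation exchanges weights 1 and [n.-1], which are distinct levels since [2 < n]; hence
    the factor 2. *)
Lemma sum_extremal (F : vec -> rat) : (2 < n)%N ->
  (forall S, weight S != 1%N -> weight S != n.-1 -> F S = 0) ->
  (forall S, F (compl S) = F S) -> \sum_S F S = 2 * \sum_i F (delta i).
Proof.
move=> n2 F0 FC.
have sum1 : \sum_(S | weight S == 1%N) F S = \sum_i F (delta i).
  rewrite -(@big_imset _ _ _ _ _ delta predT F) /=; last by move=> i j _ _; apply: delta_inj.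
  apply: eq_bigl => S; apply/weight1P/imsetP => [[i ->]|[i _ ->]]; by exists i.
rewrite (bigID (fun S => weight S == 1%N)) /= sum1.
have -> : \sum_(S | weight S != 1%N) F S = \sum_(S | weight S == n.-1) F S.
  rewrite (bigID (fun S => weight S == n.-1)) /= [X in _ + X]big1 ?addr0.
    by apply: eq_bigl => S; apply: andb_idl => /eqP->; lia.
  by move=> S /andP[]; apply: F0.
rewrite (reindex_inj (can_inj complK)) /= -sum1.
rewrite [X in _ + X](eq_big (fun S => weight S == 1%N) F) //; first by ring.
by move=> S; have := weight_compl S; lia.
Qed.

Lemma weight_pair i j : ~~ odd (weight (vadd (delta i) (delta j))).
Proof. by rewrite odd_weightD !weight_delta. Qed.

(** * Sign-valued functions that are linear in the coordinate signs *)

Section Degree1.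
Variables (a : 'I_n -> rat) (g : vec -> rat).
Hypothesis n4 : (4 < n)%N.
Hypothesis ga : forall x, ~~ odd (weight x) -> g x = \sum_i a i * (-1) ^+ x i.
Hypothesis g1 : forall x, ~~ odd (weight x) -> g x = 1 \/ g x = -1.

(** Flipping coordinates [i] and [j] preserves even weight and changes [g] by [2 * u], while two
    signs differ by 0, 2 or -2. *)
Lemma pair_flip x i j : ~~ odd (weight x) -> i != j ->
  let u := a i * (-1) ^+ x i + a j * (-1) ^+ x j in [\/ u = 0, u = 1 | u = -1].
Proof.
move=> ex ij; set u := a i * _ + _ => /=.
pose y := vadd x (vadd (delta i) (delta j)).
have ey : ~~ odd (weight y) by rewrite odd_weightD (negbTE ex) weight_pair.
suff e : g x - g y = 2 * u.
  by case: (g1 ex) => gx; case: (g1 ey) => gy; rewrite gx gy in e;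
    [constructor 1|constructor 2|constructor 3|constructor 1]; lra.
rewrite !ga // -sumrB (bigD1 i) //= (bigD1 j) 1?eq_sym //= big1 => [|l /andP[li lj]].
  rewrite !ffunE !eqxx (negbTE ij) eq_sym (negbTE ij) /= !addbT addr0 /u.
  by case: (x i); case: (x j) => /=; ring.
by rewrite !ffunE (negbTE li) (negbTE lj) !addbF subrr.
Qed.

Lemma other_index i j : exists2 l, l != i & l != j.
Proof.
have : (0 < #|~: [set i; j]|)%N.
  by rewrite cardsCs setCK card_ord cards2; case: (_ != _); lia.
by case/card_gt0P => l; rewrite !inE negb_or => /andP[]; exists l.
Qed.

(** The sum comes from flipping at the zero vector. The difference needs an even vector containing
    [i] but not [j], hence a third index [l]. *)
Lemma pair_sum_diff i j : i != j ->
  [\/ a i + a j = 0, a i + a j = 1 | a i + a j = -1] /\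
  [\/ a j - a i = 0, a j - a i = 1 | a j - a i = -1].
Proof.
move=> ij; split.
  by have := @pair_flip (vzero n) i j; rewrite weight_zero !ffunE !mulr1; apply.
have [l li lj] := other_index i j.
have := @pair_flip (vadd (delta i) (delta l)) i j (weight_pair _ _) ij.
rewrite !ffunE eqxx ![_ == l]eq_sym (negbTE li) (negbTE lj) eq_sym (negbTE ij) /=.
by rewrite expr1 expr0 mulr1 mulrN1 addrC.
Qed.

(** Choose [x] so that every term is [1/2], except perhaps at [i0], which is toggled to repair
    parity. As [n > 4], the sum is at least [4/2 - 1/2 > 1], too large for [g]. *)
Lemma coef_not_all_half : ~ forall i, a i = 2^-1 \/ a i = - 2^-1.
Proof.
move=> ha; pose i0 : 'I_n := Ordinal (ltn_trans (isT : 0 < 4)%N n4).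
pose T : vec := [ffun i => a i < 0].
pose T' := if odd (weight T) then vadd T (delta i0) else T.
have eT' : ~~ odd (weight T').
  rewrite /T'; case: ifP => [oT|->] //.
  by rewrite odd_weightD oT weight_delta.
have T'E i : i != i0 -> T' i = (a i < 0).
  by move=> /negbTE ii0; rewrite /T'; case: ifP => _; rewrite !ffunE ?ii0 ?addbF.
have := ga eT'; rewrite (bigD1 i0) //=.
rewrite (eq_bigr (fun=> 2^-1)); last first.
  by move=> i ii0; rewrite T'E //; case: (ha i) => -> ; case: ltP => /=; lra.
rewrite sumr_const cardC1 card_ord -mulr_natr.
have : 4 <= n.-1%:R :> rat by rewrite (ler_nat _ 4); lia.
have : - 2^-1 <= a i0 * (-1) ^+ T' i0.
  by case: (ha i0) => ->; case: (T' i0) => /=; lra.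
by case: (g1 eT') => ->; lra.
Qed.

Lemma degree1_coordinate : exists i, forall x, ~~ odd (weight x) ->
  g x = g (vzero n) * (-1) ^+ x i.
Proof.
have e0 : ~~ odd (weight (vzero n)) by rewrite weight_zero.
have g0 : g (vzero n) = \sum_i a i.
  by rewrite ga //; apply: eq_bigr => i _; rewrite ffunE mulr1.
have [i ai] : exists i, a i != 0.
  apply/existsP; apply: contraT => /existsPn h.
  have : \sum_i a i = 0 by rewrite big1 // => i _; apply/eqP; rewrite -[_ == _]negbK h.
  by rewrite -g0; case: (g1 e0) => ->; lra.
have a0 j : j != i -> a j = 0.
  (* Two nonzero coefficients with sum and difference in [{0, 1, -1}] both have absolute value
     [1/2]; comparison with [i] then spreads this to all indices. *)
  move=> ji; have [//|aj] := eqVneq (a j) 0; exfalso; apply: coef_not_all_half.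
  have hi : a i = 2^-1 \/ a i = - 2^-1.
    move/eqP: ai; move/eqP: aj.
    have [[] s [] d] := pair_sum_diff ji; lra.
  move=> l; have [->//|li] := eqVneq l i.
  have [[] s [] d] := pair_sum_diff li; case: hi; lra.
have gE x : ~~ odd (weight x) -> g x = a i * (-1) ^+ x i.
  by move=> ex; rewrite ga // (bigD1 i) //= big1 ?addr0 // => j /a0->; rewrite mul0r.
by exists i => x ex; rewrite !gE // ffunE mulr1.
Qed.

End Degree1.

Lemma extremal_coordinate k (g : vec -> rat) :
  ~~ odd k -> (n.+1 < 2 * k)%N -> (k < n)%N ->
  (forall x, odd (weight x) -> g x = 0) ->
  (forall x, ~~ odd (weight x) -> g x = 1 \/ g x = -1) ->
  (forall S, (kraw (weight S) (n - weight S) k - kraw 1 n.-1 k)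
             * fourier g S ^+ 2 = 0) ->
  exists i, forall x, ~~ odd (weight x) -> g x = g (vzero n) * (-1) ^+ x i.
Proof.
move=> ek h1 h2 godd g1 gS.
(* The inequalities alone would allow [n = 4], [k = 3]; evenness of [k] excludes it. *)
have n4 : (4 < n)%N by lia.
have gS0 S : weight S != 1%N -> weight S != n.-1 -> fourier g S = 0.
  move=> S1 S2; have wS := weight_compl S.
  have /eqP := gS S; rewrite mulf_eq0 sqrf_eq0 => /orP[|/eqP//].
  have := @kraw_min_lt (weight S) (n - weight S) k ek.
  rewrite subnKC; last by lia.
  move=> /(_ ltac:(lia) ltac:(lia) ltac:(lia) ltac:(lia)); lra.
have gC S : fourier g (compl S) = fourier g S.
  apply: eq_bigr => x _; have [ox|ex] := boolP (odd (weight x)).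
    by rewrite godd // !mul0r.
  by rewrite chi_compl.
(* The [2 ^+ n] is the normalisation of Fourier inversion; the 2 counts each character together with
   its complement. *)
apply: (@degree1_coordinate (fun i => 2 / 2 ^+ n * fourier g (delta i))) => // x ex.
apply: (@mulfI _ (2 ^+ n)); first by rewrite expf_neq0.
rewrite -fourier_inversion sum_extremal.
- rewrite !mulr_sumr; apply: eq_bigr => i _; rewrite chi_delta.
  by field; rewrite expf_neq0.
- by lia.
- by move=> S S1 S2; rewrite gS0 // mul0r.
by move=> S; rewrite gC chi_compl.
Qed.

End Coordinates.

(** * Homomorphisms *)

Section Equality.
Local Open Scope ring_scope.

Lemma sum_distance n k (x : {ffun 'I_n -> bool}) :
  \sum_(y | weight (vadd x y) == k) 1 = kraw 0 n k.
Proof.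
rewrite (reindex_inj (can_inj (vaddK x))) /=.
rewrite (eq_bigl (fun z => weight z == k)); last by move=> z; rewrite vaddK.
have := fourier_weight k (vzero n); rewrite weight_zero subn0 => <-.
rewrite big_mkcond; apply: eq_bigr => z _ /=.
rewrite /chi big1 ?mulr1; first by case: (_ == _).
by move=> i _; rewrite ffunE.
Qed.

(** [Q i] is the spectral excess of [g i], nonnegative because [t] is the least eigenvalue; [B] is
    the total slack in the edge inequalities. Together they sum to zero, so every spectral term and
    every slack vanishes. *)
Lemma spectral_equality n k n' k' (g : 'I_n' -> {ffun 'I_n -> bool} -> rat) :
  ~~ odd k -> (n.+1 < 2 * k)%N -> (k < n)%N -> (n * k' = n' * k)%N ->
  (forall i x, odd (weight x) -> g i x = 0) ->
  (forall i x, ~~ odd (weight x) -> g i x = 1 \/ g i x = -1) ->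
  (forall x y, ~~ odd (weight x) -> weight (vadd x y) = k ->
     \sum_i g i x * g i y <= n'%:R - 2 * k'%:R) ->
  (forall i S, (kraw (weight S) (n - weight S) k - kraw 1 n.-1 k)
               * fourier (g i) S ^+ 2 = 0) /\
  (forall x y, ~~ odd (weight x) -> weight (vadd x y) = k ->
     \sum_i g i x * g i y = n'%:R - 2 * k'%:R).
Proof.
move=> ek h1 h2 ratio godd g1 edge.
set t := kraw 1 n.-1 k; set c : rat := n'%:R - 2 * k'%:R.
pose ev (x : {ffun 'I_n -> bool}) : rat := (~~ odd (weight x))%:R.
pose p x y := \sum_i g i x * g i y.
pose Q i := \sum_x \sum_(y | weight (vadd x y) == k) g i x * g i y
            - t * \sum_x g i x ^+ 2.
pose B := \sum_x \sum_(y | weight (vadd x y) == k) (ev x * c - p x y).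
have term_ge0 i S : 0 <= (kraw (weight S) (n - weight S) k - t) * fourier (g i) S ^+ 2.
  apply: mulr_ge0; last exact: sqr_ge0.
  have wS := weight_compl S; rewrite subr_ge0.
  have := @kraw_min (weight S) (n - weight S) k ek.
  by rewrite subnKC; [apply|]; lia.
have QE i : 2 ^+ n * Q i =
    \sum_S (kraw (weight S) (n - weight S) k - t) * fourier (g i) S ^+ 2.
  by rewrite kraw_quadratic.
have Q0 i : 0 <= Q i.
  rewrite -(pmulr_rge0 _ (exprn_gt0 n (ltr0n rat 2))) QE.
  exact: sumr_ge0.
have pair0 x y : weight (vadd x y) == k -> 0 <= ev x * c - p x y.
  move/eqP=> wk; rewrite subr_ge0 /ev; case: (boolP (odd _)) => ox /=.
    by rewrite mul0r /p big1 // => i _; rewrite godd // mul0r.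
  by rewrite mul1r; apply: edge.
have B0 : 0 <= B by apply: sumr_ge0 => x _; apply: sumr_ge0 => y; apply: pair0.
have total : \sum_i Q i + B = 0.
  have sqE : \sum_i \sum_x g i x ^+ 2 = n'%:R * \sum_x ev x.
    rewrite mulr_natl -[in RHS](card_ord n') -sumr_const.
    apply: eq_bigr => i _; apply: eq_bigr => x _; rewrite /ev.
    case: (boolP (odd _)) => ox /=; first by rewrite godd // expr0n.
    by case: (g1 i x ox) => ->; rewrite ?sqrrN expr1n.
  have pE : \sum_i \sum_x \sum_(y | weight (vadd x y) == k) g i x * g i y =
      \sum_x \sum_(y | weight (vadd x y) == k) p x y.
    by rewrite exchange_big; apply: eq_bigr => x _; rewrite exchange_big.
  have cE : \sum_x \sum_(y | weight (vadd x y) == k) ev x * c =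
      (\sum_x ev x) * (c * kraw 0 n k).
    rewrite mulr_suml; apply: eq_bigr => x _.
    by rewrite -(sum_distance k x) !mulr_sumr; apply: eq_bigr => y _; rewrite mulr1.
  (* The ratio hypothesis makes the edge bound [c] times the degree equal to the spectral bound [t]
     times [n'], which is why nothing is left over in [total]. *)
  have cN : c * kraw 0 n k = t * n'%:R.
    have n0 : n%:R != 0 :> rat by rewrite pnatr_eq0; lia.
    apply: (mulfI n0); have /(congr1 (fun m : nat => m%:R : rat)) := ratio.
    have := @kraw1_mul n k; rewrite -/t => /(_ ltac:(lia)) e; rewrite !natrM => r.
    rewrite !mulrA e -[LHS]/(n%:R * (n'%:R - 2 * k'%:R) * kraw 0 n k) mulrBr.
    by rewrite (mulrCA _ 2) r; ring.
  rewrite /Q sumrB pE -mulr_sumr sqE /B.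
  under [X in _ + X]eq_bigr do rewrite sumrB.
  rewrite sumrB cE cN; ring.
have sQ0 : 0 <= \sum_i Q i by apply: sumr_ge0.
have {}sQ0 : \sum_i Q i = 0 by lra.
have {}B0 : B = 0 by lra.
split.
  move=> i S; have Qi : Q i = 0 by apply: (psumr_eq0P _ sQ0).
  have := QE i; rewrite Qi mulr0 => /esym sS.
  by apply: (psumr_eq0P _ sS).
move=> x y ex /eqP wk.
have sx : \sum_(y | weight (vadd x y) == k) (ev x * c - p x y) = 0.
  by apply: (psumr_eq0P _ B0) => // z _; apply: sumr_ge0 => w; apply: pair0.
have := psumr_eq0P (fun y => @pair0 x y) sx wk.
by rewrite /ev ex mul1r /p; lra.
Qed.

End Equality.

(** * Coordinate selection and multiplicities *)

Lemma hdistE m (x y : evenvec m) : hdist x y = weight (vadd (val x) (val y)).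
Proof.
rewrite /hdist /weight; congr #|pred_of_set _|; apply/setP => i.
by rewrite !inE ffunE; case: (val x i); case: (val y i).
Qed.

(** Exchange argument: add [i] or [j] to one set of size [k.-1] avoiding both, which exists because
    [k.-1 <= n - 2]. *)
Lemma subset_sums_constant n k k' (m : 'I_n -> nat) : 0 < k < n ->
  (forall A : {set 'I_n}, #|A| = k -> \sum_(i in A) m i = k') ->
  forall i j, m i = m j.
Proof.
move=> hk hA i j; have [->//|ij] := eqVneq i j.
have cC : #|~: [set i; j]| = n - 2 by rewrite cardsCs setCK card_ord cards2 ij.
have : 0 < #|[set A : {set 'I_n} | A \subset ~: [set i; j] & #|A| == k.-1]|.
  by rewrite cards_draws cC bin_gt0; lia.
case/card_gt0P => A; rewrite inE => /andP[/subsetP sA /eqP cA].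
have [iA jA] : i \notin A /\ j \notin A.
  by split; apply/negP => /sA; rewrite !inE eqxx ?orbT.
have := hA (i |: A); have := hA (j |: A).
rewrite !cardsU1 iA jA cA !big_setU1 //=; lia.
Qed.

(** Taking the exclusive or of two values cancels the unknown bit of [f] at the zero vector, that
    is, a possible complementation of the selected coordinate. *)
Lemma coordinate_selection (n k n' k' : nat)
  (hk1 : n.+1 < 2 * k) (hk2 : k < n) (hratio : n * k' = n' * k)
  (hke : ~~ odd k) (f : evenvec n -> evenvec n')
  (hf : forall x y, hdist x y = k -> k' <= hdist (f x) (f y)) :
  (forall x y, hdist x y = k -> hdist (f x) (f y) = k') /\
  exists phi : 'I_n' -> 'I_n, forall x y i,
    val (f x) i (+) val (f y) i = val x (phi i) (+) val y (phi i).
Proof.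
(* Where [insub] fails, the vector has odd weight and the default 0 gives the extension by zero. *)
pose g i x : rat := if insub x is Some u then ((-1) ^+ (val (f u) i))%R else 0%R.
have gS i (u : evenvec n) : g i (val u) = ((-1) ^+ (val (f u) i))%R.
  by rewrite /g valK.
have gge (u v : evenvec n) : (\sum_i g i (val u) * g i (val v) =
    n'%:R - 2 * (hdist (f u) (f v))%:R)%R.
  by rewrite hdistE -sum_sign; apply: eq_bigr => i _; rewrite !gS.
have even2 x y : ~~ odd (weight x) -> weight (@vadd n x y) = k -> ~~ odd (weight y).
  by move=> ex wk; have := odd_weightD x y; rewrite wk (negbTE hke) (negbTE ex) /= => <-.
have [|||gf geq] := @spectral_equality n k n' k' g hke hk1 hk2 hratio.
- by move=> i x ox; rewrite /g insubF ?ox.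
- move=> i x ex; rewrite -[x]/(val (Sub x ex : evenvec n)) gS.
  by case: (val (f _) i); [right|left].
- move=> x y ex wk; have ey := even2 x y ex wk.
  have := gge (Sub x ex) (Sub y ey); rewrite /= => ->.
  rewrite lerD2l lerN2 ler_pM2l // ler_nat; apply: hf.
  by rewrite hdistE.
split.
  move=> u v; rewrite hdistE => wk; have := geq _ _ (valP u) wk.
  rewrite gge => e; apply/eqP; rewrite -(eqr_nat rat); apply/eqP; lra.
have coord i : exists j, forall x, ~~ odd (weight x) ->
    (g i x = g i (vzero n) * (-1) ^+ x j)%R.
  apply: (@extremal_coordinate n k) => // x.
  - by move=> ox; rewrite /g insubF ?ox.
  - move=> ex; rewrite -[x]/(val (Sub x ex : evenvec n)) gS.
    by case: (val (f _) i); [right|left].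
have /fin_all_exists[phi hphi] := coord.
exists phi => u v i.
have := hphi i _ (valP u); have := hphi i _ (valP v).
rewrite !gS; have := gS i (Sub (vzero n) _ : evenvec n).
move=> /(_ ltac:(by rewrite weight_zero)) /= ->.
rewrite -!signr_addb => /signr_inj -> /signr_inj ->.
by rewrite addbACA addbb.
Qed.

Theorem theorem5p4 (n k n' k' : nat)
  (hk1 : n.+1 < 2 * k) (hk2 : k < n)
  (hk'0 : 0 < k') (hk'n : k' <= n')
  (hratio : n * k' = n' * k)
  (hke : ~~ odd k) (hk'e : ~~ odd k')
  (G : evenvec n -> evenvec n -> Prop) (G' : evenvec n' -> evenvec n' -> Prop)
  (hG : between_graph k G) (hG' : between_graph k' G')
  (f : evenvec n -> evenvec n') (hf : is_hom G G' f) :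
  (exists c : nat, n' = c * n /\ k' = c * k) /\ injective f.
Proof.
have [feq [phi hphi]] : (forall x y, hdist x y = k -> hdist (f x) (f y) = k') /\
  exists phi : 'I_n' -> 'I_n, forall x y i,
    val (f x) i (+) val (f y) i = val x (phi i) (+) val y (phi i).
  apply: coordinate_selection => // x y xy.
  by case: hG' => _ [_]; apply; apply: hf; case: hG => _ [+ _]; apply.
(* With these multiplicities as weights, [f] pulls the Hamming distance back to a weighted one. *)
pose m i := #|[set i' | phi i' == i]|.
have distE x y : hdist (f x) (f y) = \sum_(i | val x i != val y i) m i.
  rewrite hdistE weightE.
  rewrite (eq_bigr (fun i' => val x (phi i') (+) val y (phi i') : nat)); last first.
    by move=> i _; rewrite ffunE hphi.
  rewrite (partition_big phi xpredT) //= [RHS]big_mkcond; apply: eq_bigr => i _.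
  rewrite (eq_bigr (fun=> val x i (+) val y i : nat)) => [|i' /eqP->//].
  rewrite sum_nat_cond_const /m; case: (val x i); case: (val y i);
  by rewrite /= ?muln0 ?muln1.
have mA (A : {set 'I_n}) : #|A| = k -> \sum_(i in A) m i = k'.
  (* The indicator of [A] lies at distance [k] from the zero vector, so [feq] applies to this
     pair. *)
  move=> cA; pose a : {ffun 'I_n -> bool} := [ffun i => i \in A].
  have wa : weight a = k.
    by rewrite -cA /weight; congr #|pred_of_set _|; apply/setP => i; rewrite inE ffunE.
  have ea : ~~ odd (weight a) by rewrite wa.
  have ez : ~~ odd (weight (vzero n)) by rewrite weight_zero.
  have e : hdist (Sub a ea : evenvec n) (Sub (vzero n) ez) = k.
    rewrite hdistE -wa; congr weight; apply/ffunP => i.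
    by rewrite !ffunE addbF.
  rewrite -(feq _ _ e) distE; apply: eq_bigl => i.
  by rewrite !ffunE; case: (i \in A).
have mconst := @subset_sums_constant n k k' m ltac:(lia) mA.
pose i0 : 'I_n := Ordinal (leq_ltn_trans (leq0n k) hk2).
have n'E : n' = m i0 * n.
  rewrite -[LHS]card_ord -sum1_card (partition_big phi xpredT) //=.
  rewrite (eq_bigr (fun=> m i0)); first by rewrite sum_nat_const card_ord mulnC.
  by move=> i _; rewrite (mconst i0 i) sum1dep_card.
split; first by exists (m i0); split=> //; nia.
(* A coordinate where [x] and [y] differ adds [m i0] to the distance of their images. If that
   distance is 0, then [m i0 = 0] and [n' = 0], against [0 < k' <= n']. *)
move=> x y fxy; apply/val_inj/ffunP => i; apply/eqP; apply: contraT => xyi.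
have := distE x y; rewrite fxy (bigD1 i) //= (mconst i i0).
rewrite hdistE (_ : vadd _ _ = vzero n'); last by apply/eqP; rewrite vadd_eq0.
by rewrite weight_zero; nia.
Qed.
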